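(* Let $(X,d)$ be a complete separable metric space, $T\colon X\to X$ continuous and $u\colon X\to\mathbb{R}$ uniformly continuous. Let $Z\subset X$ with $0<\underline{u}(x)\le\overline{u}(x)<\infty$ for all $x\in Z$. Then $$\dim_{\mathrm{BS}}(Z,T,u)=\sup\{s\mid\underline{P}(Z,T,-su)>0\}=\inf\{s\mid\underline{P}(Z,T,-su)\le0\},$$ $$\mathrm{Dim}_{\mathrm{BS}}(Z,T,u)=\sup\{s\mid\overline{P}(Z,T,-su)>0\}=\inf\{s\mid\overline{P}(Z,T,-su)\le0\}.$$ Assume moreover that $\underline{h}(Z,T)<\infty$ (respectively $\overline{h}(Z,T)<\infty$). (i) (Existence) If $\overline{u}(x)\le\beta<\infty$ on $Z$, then the lower (respectively upper) Bowen pressure equation $$\underline{P}(Z,T,-su)=0,\qquad \overline{P}(Z,T,-su)=0,$$ has a solution, given by $s_0=\dim_{\mathrm{BS}}(Z,T,u)$ (respectively $s_0=\mathrm{Dim}_{\mathrm{BS}}(Z,T,u)$). (ii) (Uniqueness) If $\underline{u}(x)\ge\alpha>0$ on $Z$, then $s\mapsto\underline{P}(Z,T,-su)$ and $s\mapsto\overline{P}(Z,T,-su)$ are strictly decreasing; in particular each equation has at most one solution. In particular, under $0<\alpha\le\underline{u}(x)\le\overline{u}(x)\le\beta<\infty$ on $Z$, the lower and upper Bowen pressure equations have unique solutions, given by $\dim_{\mathrm{BS}}(Z,T,u)$ and $\mathrm{Dim}_{\mathrm{BS}}(Z,T,u)$ respectively.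
   Context: Conventions: $\log$ is base $2$; quantities may be infinite; $\inf\emptyset=\infty$. Here $\alpha,\beta$ are constants independent of $x$. Dynamics: for $f\colon X\to\mathbb{R}$, $S_nf=\sum_{k=0}^{n-1}f\circ T^k$; $\underline{u}(x)=\liminf_n\frac1nS_nu(x)$, $\overline{u}(x)=\limsup_n\frac1nS_nu(x)$; the Bowen ball is $B_n(x,T,\varepsilon)=\{y\in X: d(T^ix,T^iy)<\varepsilon \text{ for } 0\le i<n\}$; for uniformly continuous $f$, $f(x,n,\varepsilon)=\sup_{y\in B_n(x,T,\varepsilon)}S_nf(y)$. Let $\mathcal{P}(Z,N,\varepsilon)$ be the collection of countable families $\{(y_j,n_j)\}\subset X\times\{N,N+1,\dots\}$ with $Z\subset\bigcup_jB_{n_j}(y_j,T,\varepsilon)$. Lower (Pesin–Pitskel) pressure of uniformly continuous $\varphi$: $m_P(Z,s,\varphi,\varepsilon)=\lim_{N\to\infty}\inf_{\mathcal{P}(Z,N,\varepsilon)}\sum_j2^{-n_js+\varphi(y_j,n_j,\varepsilon)}$ for $s\in\mathbb{R}$; $\underline{P}(Z,T,\varphi,\varepsilon)=\inf\{s\in\mathbb{R}:m_P(Z,s,\varphi,\varepsilon)=0\}$; $\underline{P}(Z,T,\varphi)=\lim_{\varepsilon\to0}\underline{P}(Z,T,\varphi,\varepsilon)$. Upper (packing) pressure, in modified upper capacity form: $N(Z,T,\varphi,n,\varepsilon)=\inf\{\sum_{x\in E}2^{\varphi(x,n,\varepsilon)}:E\subset X\text{ countable},Z\subset\bigcup_{x\in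 E}B_n(x,T,\varepsilon)\}$; $P_{\mathrm{UC}}(Z,T,\varphi,\varepsilon)=\limsup_n\frac1n\log N(Z,T,\varphi,n,\varepsilon)$; $\overline{P}(Z,T,\varphi)=\lim_{\varepsilon\to0}\inf\{\sup_iP_{\mathrm{UC}}(Z_i,T,\varphi,\varepsilon):Z\subset\bigcup_{i\in\mathbb{N}}Z_i\}$. Entropies: $\underline{h}(Z,T)=\underline{P}(Z,T,0)$ (Bowen entropy) and $\overline{h}(Z,T)=\overline{P}(Z,T,0)$ (packing entropy). Lower BS dimension: $m_{BS}(Z,s,u,\varepsilon)=\lim_{N\to\infty}\inf_{\mathcal{P}(Z,N,\varepsilon)}\sum_j2^{-s\,u(y_j,n_j,\varepsilon)}$ for $s\ge0$; $\dim_{\mathrm{BS}}(Z,T,u)=\lim_{\varepsilon\to0}\inf\{s\ge0:m_{BS}(Z,s,u,\varepsilon)=0\}$. Upper BS dimension: $M(Z,T,u,s,n,\varepsilon)=\inf\{\sum_{x\in\Gamma}2^{-s\,u(x,n,\varepsilon)}:\Gamma\subset X\text{ countable},Z\subset\bigcup_{x\in\Gamma}B_n(x,T,\varepsilon)\}$; $\dim_{\mathrm{BSC}}(Z,T,u,\varepsilon)=\inf\{s\ge0:\limsup_nM(Z,T,u,s,n,\varepsilon)<\infty\}$; $\mathrm{Dim}_{\mathrm{BS}}(Z,T,u)=\lim_{\varepsilon\to0}\inf\{\sup_i\dim_{\mathrm{BSC}}(Z_i,T,u,\varepsilon):Z\subset\bigcup_{i\in\mathbb{N}}Z_i\}$.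
   Formalization: Z is assumed nonempty; in (i) the dimension is assumed finite (otherwise no real solution exists); in (ii) strict decrease is stated for 0≤s<t and for all real s<t with finite pressure at t, since the pressure can be +∞ for negative s. *)

(* Defs.v *)
From mathcomp Require Import all_boot all_order all_algebra.
From mathcomp Require Import all_classical all_reals all_analysis.

Set Implicit Arguments.
Unset Strict Implicit.
Unset Printing Implicit Defensive.

Import Order.TTheory GRing.Theory Num.Theory.
Import numFieldNormedType.Exports.

Local Open Scope classical_set_scope.
Local Open Scope ring_scope.

(* Stated with [exists] instead of the library's [cvg], which needs a pointed
   type. *)
Definition complete_space (X : uniformType) : Prop :=
  forall F : set_system X, ProperFilter F -> cauchy F -> exists x : X, F --> x.

Definition separable_space (X : topologicalType) : Prop :=
  exists D : set X, countable D /\ dense D.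

Section ExtendedExpLog.
Context {R : realType}.
Local Open Scope ereal_scope.

(* 2 ^ x, with 2 ^ -oo = 0 and 2 ^ +oo = +oo *)
Definition pow2 (x : \bar R) : \bar R := expeR ((ln (2 : R))%:E * x).

(* base 2, with log2 0 = -oo and log2 +oo = +oo *)
Definition log2 (x : \bar R) : \bar R := ((ln (2 : R))^-1)%:E * lne x.

End ExtendedExpLog.

Section Dynamics.
Context {R : realType} {X : metricType R}.
Implicit Types (T : X -> X) (f phi u : X -> R) (Z : set X).

Definition birkhoff_sum T f (n : nat) (x : X) : R :=
  \sum_(k < n) f (iter k T x).

Definition lower_average T f (x : X) : \bar R :=
  limn_einf (fun n => (n%:R^-1 * birkhoff_sum T f n x)%:E).

Definition upper_average T f (x : X) : \bar R :=
  limn_esup (fun n => (n%:R^-1 * birkhoff_sum T f n x)%:E).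

Definition bowen_ball T (n : nat) (eps : R) (x : X) : set X :=
  [set y | forall i, (i < n)%N -> mdist (iter i T x) (iter i T y) < eps].

Local Open Scope ereal_scope.

(* f(x, n, eps); it may be +oo when f is unbounded and eps is large *)
Definition birkhoff_sup T f (n : nat) (eps : R) (x : X) : \bar R :=
  ereal_sup [set (birkhoff_sum T f n y)%:E | y in bowen_ball T n eps x].

(* Countable families of pairs (y_j, n_j) are taken as sets of pairs: repeated
   pairs would only increase the nonnegative sums which are minimised below.
   [countable] includes finite and empty. *)
Definition bowen_covers T Z (N : nat) (eps : R) : set (set (X * nat)) :=
  [set C | [/\ countable C, (forall p, C p -> (N <= p.2)%N) &
               Z `<=` \bigcup_(p in C) bowen_ball T p.2 eps p.1]].

Definition bowen_covers_at T Z (n : nat) (eps : R) : set (set X) :=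
  [set E | countable E /\ Z `<=` \bigcup_(x in E) bowen_ball T n eps x].

Definition countable_covers Z : set (nat -> set X) :=
  [set Zs | Z `<=` \bigcup_i Zs i].

Definition pressure_measure T phi Z (s eps : R) : \bar R :=
  limn (fun N => ereal_inf
    [set \esum_(p in C)
           pow2 ((- (p.2%:R * s))%:E + birkhoff_sup T phi p.2 eps p.1)
    | C in bowen_covers T Z N eps]).

Definition lower_pressure_at T phi Z (eps : R) : \bar R :=
  ereal_inf [set s%:E | s in [set s : R | pressure_measure T phi Z s eps = 0]].

(* This limit exists for uniformly continuous phi, although the function of eps
   is not monotone: a smaller eps makes covering harder but also lowers
   phi(y, n, eps). The same applies to [upper_pressure]. *)
Definition lower_pressure T phi Z : \bar R :=
  lim (lower_pressure_at T phi Z eps @[eps --> (0 : R)^'+]).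

Definition pressure_sum_at T phi Z (n : nat) (eps : R) : \bar R :=
  ereal_inf [set \esum_(x in E) pow2 (birkhoff_sup T phi n eps x)
            | E in bowen_covers_at T Z n eps].

Definition upper_capacity_pressure T phi Z (eps : R) : \bar R :=
  limn_esup (fun n => (n%:R^-1)%:E * log2 (pressure_sum_at T phi Z n eps)).

Definition upper_pressure_at T phi Z (eps : R) : \bar R :=
  ereal_inf
    [set ereal_sup (range (fun i => upper_capacity_pressure T phi (Zs i) eps))
    | Zs in countable_covers Z].

Definition upper_pressure T phi Z : \bar R :=
  lim (upper_pressure_at T phi Z eps @[eps --> (0 : R)^'+]).

Definition bowen_entropy T Z : \bar R := lower_pressure T (fun=> 0%R) Z.

Definition packing_entropy T Z : \bar R := upper_pressure T (fun=> 0%R) Z.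

Definition BS_measure T u Z (s eps : R) : \bar R :=
  limn (fun N => ereal_inf
    [set \esum_(p in C) pow2 (- (s%:E * birkhoff_sup T u p.2 eps p.1))
    | C in bowen_covers T Z N eps]).

Definition lower_BS_dim_at T u Z (eps : R) : \bar R :=
  ereal_inf
    [set s%:E | s in [set s : R | (0 <= s)%R /\ BS_measure T u Z s eps = 0]].

Definition lower_BS_dim T u Z : \bar R :=
  lim (lower_BS_dim_at T u Z eps @[eps --> (0 : R)^'+]).

Definition BS_sum_at T u Z (s : R) (n : nat) (eps : R) : \bar R :=
  ereal_inf [set \esum_(x in E) pow2 (- (s%:E * birkhoff_sup T u n eps x))
            | E in bowen_covers_at T Z n eps].

Definition BS_capacity_dim T u Z (eps : R) : \bar R :=
  ereal_inf
    [set s%:E | s in [set s : R | (0 <= s)%R /\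
                        limn_esup (fun n => BS_sum_at T u Z s n eps) < +oo]].

Definition upper_BS_dim_at T u Z (eps : R) : \bar R :=
  ereal_inf [set ereal_sup (range (fun i => BS_capacity_dim T u (Zs i) eps))
            | Zs in countable_covers Z].

Definition upper_BS_dim T u Z : \bar R :=
  lim (upper_BS_dim_at T u Z eps @[eps --> (0 : R)^'+]).

(* The pressure functions s |-> P(Z, T, - s u). *)
Definition lower_bowen_fun T u Z (s : R) : \bar R :=
  lower_pressure T (fun x => - s * u x)%R Z.

Definition upper_bowen_fun T u Z (s : R) : \bar R :=
  upper_pressure T (fun x => - s * u x)%R Z.

End Dynamics.

(* Main.v *)
Require Import Defs.
From mathcomp Require Import all_boot all_order all_algebra.
From mathcomp Require Import all_classical all_reals all_analysis.
From mathcomp Require Import ring lra.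

Import Order.TTheory GRing.Theory Num.Theory.
Import numFieldNormedType.Exports.

Local Open Scope classical_set_scope.
Local Open Scope ring_scope.
Local Open Scope ereal_scope.

Set Implicit Arguments.
Unset Strict Implicit.
Unset Printing Implicit Defensive.

(** Write [S_n u] for Birkhoff sums, [p s] for the pressure of [- s u] on [Z]
    and [D] for the dimension of [Z].

    By uniform continuity, at small scales [eps] the supremum of [S_n u] over a
    Bowen ball meeting a set [W] is within [n * eta] of its value at the centre,
    and that value is within [n * eta] of the value at a point of [W]. Hence if
    [(s - t) * S_n u <= n * c] holds on [W] for all large [n], uniformly, the
    weights that define the pressure of [- t u] are at most those of [- s u]
    shifted by [n * (c + eta)], and the pressure of [- t u] on [W] is at most
    that of [- s u] plus [c] ([pressure_compare]). For [t = s] and [c = 0],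
    comparing two scales instead of one shows that the limit as [eps] tends to
    [0] exists and that the error at scale [eps] is bounded uniformly in [W];
    this uniformity makes the limit compatible with countable unions
    ([pressure_bigcup]).

    The weight [2 ^ (- s u(y, n, eps))] of the dimension is, up to a factor
    [2 ^ (n * eta)], the weight of the pressure of [- s u] at level [0].
    Therefore [p s < 0] implies [D <= s] for [s >= 0], and [D < s] implies
    [p s <= 0]. The gap left at [p s = 0] is closed on the sets where
    [n / (k + 1) <= S_n u <= n * (k + 1)] for all [n >= k]. They exhaust [Z]
    because of the hypothesis on averages, and on each of them the pressure
    decreases in [s] with slope at most [- 1 / (k + 1)], so that [p s <= 0]
    makes it negative just after [s]. Countable stability of the dimension then
    gives [D <= s] ([dimension_le_of_pressure], [pressure_le0_of_dimension]),
    and both formulas for [D] follow. A nonempty [Z] has [p 0 >= 0], which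
    excludes negative [s] from the infimum.

    An upper bound [beta] on the averages bounds the rate at which [p] can
    decrease, so [p] cannot jump over [0] at [D] ([pressure_dimension]); a lower
    bound [alpha > 0] gives [p t <= p s - (t - s) * alpha / 2] for [s < t],
    hence uniqueness, and also [D < +oo] as soon as the entropy [p 0] is finite.

    The lower and the upper theory differ only in which weighted families of
    Bowen balls count as negligible. The argument uses three properties of that
    notion, isolated in [smallness], and is carried out once; [null_smallness]
    and [scapped_smallness] establish them in the two cases. *)

(** * Limits at scale zero *)
Section RightLimits.
Context {R : realType}.
Implicit Types (g : R -> \bar R) (a b : \bar R).

Lemma lee_real a b : (forall r : R, b < r%:E -> a <= r%:E) -> a <= b.
Proof.
case: b => [b||] h; last 2 first.
- exact: leey.
- case: a h => [a||] h //.
    by have := h (a - 1)%R (ltNyr _); rewrite lee_fin lerBrDr gerDl ler10.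
  by have := h 0%R (ltNyr _); rewrite leye_eq.
apply/lee_addgt0Pr => e e0; rewrite -EFinD; apply: h.
by rewrite lte_fin ltrDl.
Qed.

Lemma near_right0 (P : R -> Prop) (delta : R) : (0 < delta)%R ->
  (forall e, (0 < e)%R -> (e < delta)%R -> P e) ->
  \forall e \near (0%R : R)^'+, P e.
Proof.
move=> d0 h; near=> e; apply: h; near: e.
  exact: nbhs_right_gt.
exact: nbhs_right_lt.
Unshelve. all: by end_near. Qed.

(** Shrinking [eps] makes covering harder but also lowers the suprema over the
    balls, so critical pressures are monotone in [eps] only up to an error that
    vanishes with [eps]. *)
Definition almost_nonincreasing0 g := forall eta : R, (0 < eta)%R ->
  exists2 delta : R, (0 < delta)%R &
    forall e e', (0 < e)%R -> (e <= e')%R -> (e' < delta)%R ->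
      g e' <= g e + eta%:E.

(** The limit is the lower limit [L] of [g]: below the threshold for [eta], any
    value of [g] exceeds all later infima, hence [L], by at most [eta]. *)
Lemma almost_nonincreasing0_is_cvg g : almost_nonincreasing0 g ->
  cvg (g e @[e --> (0%R : R)^'+]).
Proof.
move=> gm.
pose h d := ereal_inf [set g e | e in [set e : R | (0 < e)%R /\ (e < d)%R]].
pose L := ereal_sup [set h d | d in [set d : R | (0 < d)%R]].
have low (c : \bar R) : c < L -> \forall e \near (0%R : R)^'+, c < g e.
  move=> /ereal_sup_gtP[_ [d /= d0 <-] cd]; apply: (near_right0 d0) => e e0 ed.
  by apply: (lt_le_trans cd); apply: ereal_inf_lbound; exists e.
have high (eta : R) : (0 < eta)%R ->
    \forall e \near (0%R : R)^'+, g e <= L + eta%:E.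
  move=> eta0; have [d d0 hd] := gm _ eta0; apply: (near_right0 d0) => e e0 ed.
  rewrite -leeBlDr//; apply: ereal_sup_ge; exists (h e); first by exists e.
  apply/ereal_infP => _ [e' [e'0 e'e] <-]; rewrite leeBlDr//.
  exact: hd e'0 (ltW e'e) ed.
apply/cvg_ex; exists L; case: L low high => [l||] low high.
- apply/fine_cvgP; split.
    near=> e; apply/fin_real/andP; split.
      apply: (@le_lt_trans _ _ (l - 1)%:E) => //; first exact: leNye.
      near: e; apply: low; by rewrite lte_fin gtrBl.
    apply: (@le_lt_trans _ _ (l%:E + 1%:E)); last by rewrite -EFinD ltry.
    by near: e; exact: high.
  apply/cvgrPdist_le => /= eta eta0; near=> e.
  have h1 : (l - eta)%:E < g e.
    by near: e; apply: low; rewrite lte_fin gtrBl.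
  have h2 : g e <= (l + eta)%:E by near: e; rewrite EFinD; exact: high.
  move: h1 h2; case: (g e) => [x||] //=; rewrite lte_fin lee_fin => h1 h2.
  by rewrite distrC ler_norml; apply/andP; split; lra.
- by apply/cvgeyPgt => A; apply: low; exact: ltry.
- apply/cvgeNyPle => A; near=> e.
  rewrite (@le_trans _ _ -oo)//; last exact: leNye.
  by near: e; rewrite -[-oo](addNye 1%:E); exact: high.
Unshelve. all: by end_near. Qed.

Lemma le_almost_nonincreasing0_lim g (eta delta : R) :
  cvg (g e @[e --> (0%R : R)^'+]) ->
  (forall e e', (0 < e)%R -> (e <= e')%R -> (e' < delta)%R ->
    g e' <= g e + eta%:E) ->
  forall e, (0 < e)%R -> (e < delta)%R ->
    g e <= lim (g e @[e --> (0%R : R)^'+]) + eta%:E.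
Proof.
move=> cg h e e0 ed; rewrite -leeBlDr//; apply: lime_ge => //.
apply: (near_right0 e0) => e' e'0 e'e; rewrite leeBlDr//.
exact: h e'0 (ltW e'e) ed.
Qed.

End RightLimits.

(** * Birkhoff sums on Bowen balls *)
Section BirkhoffSums.
Context {R : realType} {X : metricType R}.
Implicit Types (T : X -> X) (f u : X -> R) (W : set X).

Lemma bowen_ball_self T n (eps : R) x : (0 < eps)%R -> bowen_ball T n eps x x.
Proof. by move=> e0 i _; rewrite mdistxx. Qed.

Lemma bowen_ball_le T n (eps eps' : R) x : (eps <= eps')%R ->
  bowen_ball T n eps x `<=` bowen_ball T n eps' x.
Proof. by move=> ee y h i /h /lt_le_trans; apply. Qed.

Lemma unif_continuous_mdist u (eta : R) : unif_continuous u -> (0 < eta)%R ->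
  exists2 delta : R, (0 < delta)%R &
    forall x y, (mdist x y < delta)%R -> (`|u x - u y| <= eta)%R.
Proof.
move=> uc eta0.
have : entourage [set xy : R * R | (`|xy.1 - xy.2| < eta)%R].
  by rewrite -entourage_ballE; exists eta.
move=> /uc; rewrite /= nbhs_simpl/= -entourage_ballE => -[d /= d0 hd].
exists d => // x y xy; apply/ltW/(hd (x, y)).
by rewrite /= -metricType_numDomainType.ball_mdistE.
Qed.

Lemma birkhoff_sumZ T u (s : R) n x :
  birkhoff_sum T (fun y => s * u y)%R n x = (s * birkhoff_sum T u n x)%R.
Proof. by rewrite /birkhoff_sum mulr_sumr. Qed.

Lemma birkhoff_sum_dist T u (eta delta : R) n x y :
  (forall x y, (mdist x y < delta)%R -> (`|u x - u y| <= eta)%R) ->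
  bowen_ball T n delta x y ->
  (`|birkhoff_sum T u n x - birkhoff_sum T u n y| <= n%:R * eta)%R.
Proof.
move=> hu xy; rewrite /birkhoff_sum -sumrB (le_trans (ler_norm_sum _ _ _))//.
rewrite -[X in (_ <= X%:R * _)%R]card_ord mulr_natl -sumr_const.
by apply: ler_sum => i _; apply/hu/xy.
Qed.

Lemma birkhoff_sup_ge T f n (eps : R) x y : bowen_ball T n eps x y ->
  (birkhoff_sum T f n y)%:E <= birkhoff_sup T f n eps x.
Proof. by move=> xy; apply: ereal_sup_ubound; exists y. Qed.

Lemma birkhoff_sup_le T f n (eps eps' : R) x : (eps <= eps')%R ->
  birkhoff_sup T f n eps x <= birkhoff_sup T f n eps' x.
Proof.
move=> ee; apply: le_ereal_sup => _ [y xy <-]; exists y => //.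
exact: bowen_ball_le ee _ xy.
Qed.

Lemma birkhoff_sup_leD T u (eta delta eps : R) n x :
  (forall x y, (mdist x y < delta)%R -> (`|u x - u y| <= eta)%R) ->
  (eps <= delta)%R ->
  birkhoff_sup T u n eps x <= (birkhoff_sum T u n x + n%:R * eta)%:E.
Proof.
move=> hu ed; apply: ge_ereal_sup => _ [y xy <-]; rewrite lee_fin.
have := birkhoff_sum_dist hu (bowen_ball_le ed xy).
by rewrite distrC ler_norml => /andP[_]; rewrite lerBlDl.
Qed.

End BirkhoffSums.

(** * Birkhoff averages *)
Section Averages.
Context {R : realType} {X : metricType R}.
Implicit Types (T : X -> X) (u : X -> R).

Lemma limn_esup_lt (v : nat -> \bar R) (c : \bar R) : limn_esup v < c ->
  exists N : nat, forall n, (N <= n)%N -> v n < c.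
Proof.
move=> /ereal_inf_ltP[_ [V [N _ NV] <-] Vc]; exists N => n Nn.
by apply: le_lt_trans Vc; apply: ereal_sup_ubound; exists n => //; exact: NV.
Qed.

Lemma limn_esup_le (v : nat -> \bar R) (c : \bar R) (N : nat) :
  (forall n, (N <= n)%N -> v n <= c) -> limn_esup v <= c.
Proof.
move=> h; apply: ge_ereal_inf; exists (ereal_sup (v @` [set n | (N <= n)%N])).
  by exists [set n | (N <= n)%N] => //; exists N.
by apply: ge_ereal_sup => _ [n Nn <-]; exact: h.
Qed.

Lemma upper_average_lt T u x (c : R) : upper_average T u x < c%:E ->
  exists k : nat, forall n, (k <= n)%N -> (birkhoff_sum T u n x <= n%:R * c)%R.
Proof.
move=> /limn_esup_lt[k hk]; exists k => -[|n] /hk.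
  by rewrite mul0r /birkhoff_sum big_ord0.
by rewrite lte_fin ltr_pdivrMl// => /ltW.
Qed.

Lemma lower_average_gt T u x (c : R) : c%:E < lower_average T u x ->
  exists k : nat, forall n, (k <= n)%N -> (n%:R * c <= birkhoff_sum T u n x)%R.
Proof.
rewrite lteNr => /limn_esup_lt[k hk]; exists k => -[|n] /hk.
  by rewrite mul0r /birkhoff_sum big_ord0.
by rewrite -EFinN lte_fin ltrN2 ltr_pdivlMl// => /ltW.
Qed.

(** A single integer serves as threshold, as upper bound and, inverted, as lower
    bound, so that countably many conditions describe all points. *)
Lemma averages_between T u x :
  0 < lower_average T u x -> upper_average T u x < +oo ->
  exists k : nat, forall n, (k <= n)%N ->
    (n%:R * k.+1%:R^-1 <= birkhoff_sum T u n x <= n%:R * k.+1%:R)%R.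
Proof.
move=> lo up.
have [a a0 alo] : exists2 a : R, (0 < a)%R & a%:E < lower_average T u x.
  move: lo; case: (lower_average T u x) => [l||] //; last first.
    by exists 1%R => //; exact: ltry.
  by rewrite lte_fin => l0; exists (l / 2)%R; rewrite ?lte_fin; lra.
have [b bup] : exists b : R, upper_average T u x < b%:E.
  move: up; case: (upper_average T u x) => [l||] //.
    by exists (l + 1)%R; rewrite lte_fin ltrDl.
  by exists 0%R; exact: ltNyr.
have [k1 h1] := lower_average_gt alo; have [k2 h2] := upper_average_lt bup.
pose k := maxn (maxn k1 k2) (maxn (Num.truncn a^-1) (Num.truncn b)).
exists k => n; rewrite geq_max => /andP[]; rewrite geq_max => /andP[kn1 kn2] _.
have ka : (a^-1 <= k.+1%:R)%R.
  apply/ltW/(lt_le_trans (truncnS_gt _)); rewrite ler_nat ltnS.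
  by rewrite !leq_max leqnn !orbT.
have kb : (b <= k.+1%:R)%R.
  apply/ltW/(lt_le_trans (truncnS_gt _)); rewrite ler_nat ltnS.
  by rewrite !leq_max leqnn !orbT.
apply/andP; split.
  by rewrite (le_trans _ (h1 _ kn1))// ler_wpM2l// invf_ple ?posrE.
by rewrite (le_trans (h2 _ kn2))// ler_wpM2l.
Qed.

End Averages.

(** * Pressure and dimension of an abstract notion of smallness *)
Section CriticalExponents.
Context {R : realType} {X : metricType R} (T : X -> X).
Implicit Types (W : set X) (w : X * nat -> \bar R) (f u : X -> R).

(** A relation [small W w eps] saying that [W] is negligible when the ball
    [B_n(x, eps)] has weight [2 ^ w (x, n)]. Only large [n] and the balls
    meeting the set matter in [small_le]: the other balls can be dropped from a
    cover. *)
Record smallness (small : set X -> (X * nat -> \bar R) -> R -> Prop) : Prop :=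
  Smallness {
  small_le : forall W W' w w' (eps eps' : R) (k : nat),
    W' `<=` W -> (eps <= eps')%R ->
    (forall p, (k <= p.2)%N -> W' `&` bowen_ball T p.2 eps p.1 !=set0 ->
       w' p <= w p) ->
    small W w eps -> small W' w' eps';
  small_bigcup : forall (Ws : nat -> set X) w eps,
    (forall i, small (Ws i) w eps) -> small (\bigcup_i Ws i) w eps;
  small_growing : forall W w (eps a : R), W !=set0 -> (0 < a)%R ->
    (forall p, (p.2%:R * a)%:E <= w p) -> ~ small W w eps }.

Variable small : set X -> (X * nat -> \bar R) -> R -> Prop.

Definition pressure_weight f (r eps : R) (p : X * nat) : \bar R :=
  (- (p.2%:R * r))%:E + birkhoff_sup T f p.2 eps p.1.

Definition dim_weight u (s eps : R) (p : X * nat) : \bar R :=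
  - (s%:E * birkhoff_sup T u p.2 eps p.1).

(** For the two notions of smallness below, these are the pressures and, for
    sets where the Birkhoff sums are eventually nonnegative, the dimensions at
    scale [eps]. *)
Definition critical_pressure f W (eps : R) : \bar R :=
  ereal_inf [set r%:E | r in
    [set r : R | small W (pressure_weight f r eps) eps]].

Definition critical_dim u W (eps : R) : \bar R :=
  ereal_inf [set s%:E | s in
    [set s : R | (0 <= s)%R /\ small W (dim_weight u s eps) eps]].

Definition pressure f W : \bar R :=
  lim (critical_pressure f W eps @[eps --> (0%R : R)^'+]).

Definition dimension u W : \bar R :=
  lim (critical_dim u W eps @[eps --> (0%R : R)^'+]).

Hypothesis smallP : smallness small.

Lemma small_subset W W' w eps : W' `<=` W -> small W w eps -> small W' w eps.
Proof. by move=> sub; apply: (small_le smallP (k := 0) sub). Qed.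

Lemma critical_pressure_le f W (r eps : R) :
  small W (pressure_weight f r eps) eps -> critical_pressure f W eps <= r%:E.
Proof. by move=> sm; apply: ereal_inf_lbound; exists r. Qed.

Lemma critical_pressure_lt f W (r eps : R) :
  critical_pressure f W eps < r%:E -> small W (pressure_weight f r eps) eps.
Proof.
move=> /ereal_inf_ltP[_ [r' sm <-]]; rewrite lte_fin => r'r.
apply: (small_le smallP (k := 0) _ _ _ sm) => // p _ _.
by rewrite /pressure_weight leeD2r// lee_fin lerN2 ler_wpM2l// ltW.
Qed.

Lemma critical_pressure_subset f W W' (eps : R) : W' `<=` W ->
  critical_pressure f W' eps <= critical_pressure f W eps.
Proof.
move=> sub; apply: lee_real => r /critical_pressure_lt sm.
exact/critical_pressure_le/(small_subset sub).
Qed.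

Lemma critical_pressure_bigcup f (Ws : nat -> set X) (eps : R) (b : \bar R) :
  (forall i, critical_pressure f (Ws i) eps <= b) ->
  critical_pressure f (\bigcup_i Ws i) eps <= b.
Proof.
move=> h; apply: lee_real => r br; apply: critical_pressure_le.
apply: (small_bigcup smallP) => i.
exact: critical_pressure_lt (le_lt_trans (h i) br).
Qed.

Variable u : X -> R.
Hypothesis u_uc : unif_continuous u.
Local Notation crit s W eps :=
  (critical_pressure (fun x => - s * u x)%R W eps).
Local Notation P s W := (pressure (fun x => - s * u x)%R W).
Local Notation S n x := (birkhoff_sum T u n x).

(** If a point [x] of [W] lies in the ball around [y], then [S_n (- t u)] at [y]
    is [S_n (- s u)] at [y] plus [(s - t) * S_n u] at [y]; the last term is
    close to its value at [x], which is at most [n * c]. Two scales are allowed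
    so that the case [s = t] controls the dependence on [eps]. *)
Lemma critical_pressure_compare (s t eta : R) : (0 < eta)%R ->
  exists2 delta : R, (0 < delta)%R &
  forall W (c : R) (k : nat) (eps eps' : R),
    (0 < eps)%R -> (eps <= eps')%R -> (eps' < delta)%R ->
    (forall x n, W x -> (k <= n)%N -> ((s - t) * S n x <= n%:R * c)%R) ->
    crit t W eps' <= crit s W eps + (c + eta)%:E.
Proof.
move=> eta0.
(* The oscillation [eta / q] of [u] enters [`|t|] times in the supremum over
   the ball and [`|s - t|] times in the passage from its centre to a point of
   [W]. *)
set q : R := (1 + `|t| + `|s - t|)%R.
have q0 : (0 < q)%R.
  by rewrite /q; have := normr_ge0 t; have := normr_ge0 (s - t)%R; lra.
have [d d0 hd] := unif_continuous_mdist u_uc (divr_gt0 eta0 q0).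
set e1 := (eta / q)%R in hd; exists d => // W c k e e' e0 ee' e'd hW.
have e10 : (0 < e1)%R by exact: divr_gt0.
have etaE : eta = (e1 * q)%R by rewrite /e1 divfK// gt_eqF.
apply: lee_real => r; rewrite -lteBrDr// -EFinB => /critical_pressure_lt sm.
apply: critical_pressure_le; apply: (small_le smallP (k := k) _ ee' _ sm) => //.
case=> y n /= kn [x [Wx yx]]; rewrite /pressure_weight/=.
have htu x1 x2 : (mdist x1 x2 < d)%R ->
    (`|- t * u x1 - - t * u x2| <= `|t| * e1)%R.
  by move=> /hd h; rewrite -mulrBr normrM normrN ler_wpM2l.
have := birkhoff_sup_leD T n y htu (ltW e'd); rewrite birkhoff_sumZ => hB'.
have := birkhoff_sup_ge (fun x => - s * u x)%R
  (@bowen_ball_self _ _ T n _ y e0).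
rewrite birkhoff_sumZ => hB.
apply: (le_trans (leeD2l _ hB')); apply: (le_trans _ (leeD2l _ hB)).
rewrite -!EFinD lee_fin.
have ed : (e <= d)%R := le_trans ee' (ltW e'd).
have h1 := birkhoff_sum_dist hd (bowen_ball_le ed yx).
have h2 := hW _ _ Wx kn.
have h3 : ((s - t) * (S n y - S n x) <= `|s - t| * (n%:R * e1))%R.
  by rewrite (le_trans (ler_norm _))// normrM ler_wpM2l.
rewrite etaE /q; clear - h2 h3 e10; have n0 : (0 <= n%:R :> R)%R by [].
have : (0 <= n%:R * e1)%R by rewrite mulr_ge0// ltW.
nra.
Qed.

Lemma pressure_cvg (s : R) W : cvg (crit s W eps @[eps --> (0%R : R)^'+]).
Proof.
apply: almost_nonincreasing0_is_cvg => eta eta0.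
have [d d0 h] := critical_pressure_compare s s eta0.
exists d => // e e' e0 ee ed.
rewrite -[eta]add0r; apply: (h W 0%R 0%N) => // x n _ _.
by rewrite subrr mul0r mulr0.
Qed.

(** The threshold for [eps] depends neither on the set nor on the value of the
    pressure, which is what lets countable unions pass to the limit. *)
Lemma critical_pressure_le_pressure (s eta : R) : (0 < eta)%R ->
  exists2 delta : R, (0 < delta)%R &
  forall W eps, (0 < eps)%R -> (eps < delta)%R ->
    crit s W eps <= P s W + eta%:E.
Proof.
move=> eta0; have [d d0 h] := critical_pressure_compare s s eta0.
exists d => // W.
apply: le_almost_nonincreasing0_lim; first exact: pressure_cvg.
move=> e e' e0 ee ed; rewrite -[eta]add0r; apply: (h W 0%R 0%N) => // x n _ _.
by rewrite subrr mul0r mulr0.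
Qed.

Lemma pressure_le (s : R) W (delta : R) (b : \bar R) : (0 < delta)%R ->
  (forall eps, (0 < eps)%R -> (eps < delta)%R -> crit s W eps <= b) ->
  P s W <= b.
Proof.
by move=> d0 h; apply: lime_le (near_right0 d0 h); exact: pressure_cvg.
Qed.

Lemma pressure_compare (s t c : R) (k : nat) W :
  (forall x n, W x -> (k <= n)%N -> ((s - t) * S n x <= n%:R * c)%R) ->
  P t W <= P s W + c%:E.
Proof.
move=> hW; apply/lee_addgt0Pr => eta eta0.
have eta20 : (0 < eta / 2)%R by rewrite divr_gt0.
have [d d0 h] := critical_pressure_compare s t eta20.
have [d' d'0 h'] := critical_pressure_le_pressure s eta20.
have dd : (0 < Num.min d d')%R by rewrite lt_min d0.
apply: (pressure_le dd) => e e0; rewrite lt_min => /andP[ed ed'].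
apply: (le_trans (h W c k e e e0 (lexx _) ed hW)).
rewrite (le_trans (leeD2r _ (h' _ _ e0 ed')))//.
rewrite -!addeA leeD2l// -!EFinD lee_fin; lra.
Qed.

Lemma pressure_subset (s : R) W W' : W' `<=` W -> P s W' <= P s W.
Proof.
move=> sub; apply/lee_addgt0Pr => eta eta0.
have [d d0 h] := critical_pressure_le_pressure s eta0.
apply: (pressure_le d0) => e e0 ed.
exact: le_trans (critical_pressure_subset _ _ sub) (h _ _ e0 ed).
Qed.

Lemma pressure_bigcup (s : R) (Ws : nat -> set X) (b : \bar R) :
  (forall i, P s (Ws i) <= b) -> P s (\bigcup_i Ws i) <= b.
Proof.
move=> hb; apply/lee_addgt0Pr => eta eta0.
have [d d0 h] := critical_pressure_le_pressure s eta0.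
apply: (pressure_le d0) => e e0 ed; apply: critical_pressure_bigcup => i.
exact: le_trans (h _ _ e0 ed) (leeD2r _ (hb i)).
Qed.

Lemma pressure_compare_bigcup (s t c : R) (Ws : nat -> set X) :
  (forall k x n, Ws k x -> (k <= n)%N -> ((s - t) * S n x <= n%:R * c)%R) ->
  P t (\bigcup_i Ws i) <= P s (\bigcup_i Ws i) + c%:E.
Proof.
move=> hW; apply: pressure_bigcup => i.
apply: (le_trans (pressure_compare (hW i))); rewrite leeD2r//.
exact: pressure_subset (bigcup_sup _).
Qed.

(** For [r < 0] the weights at level [r] are at least [n * (- r)], and such
    weights are never small on a nonempty set. *)
Lemma pressure0_ge0 W : W !=set0 -> 0 <= P 0%R W.
Proof.
move=> W0; apply: lime_ge; first exact: pressure_cvg.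
apply: (near_right0 ltr01) => e e0 _; apply/ereal_infP => _ [r sm <-].
rewrite lee_fin leNgt; apply/negP => r0.
have r0' : (0 < - r)%R by rewrite oppr_gt0.
apply: (small_growing smallP W0 r0' _ sm) => -[y n] /=.
have := birkhoff_sup_ge (fun x => - 0 * u x)%R
  (@bowen_ball_self _ _ T n _ y e0).
rewrite birkhoff_sumZ oppr0 mul0r mulrN => h.
by rewrite /pressure_weight/= -[leLHS]adde0 leeD2l// oppr0.
Qed.

Lemma critical_dim_ge0 W (eps : R) : 0 <= critical_dim u W eps.
Proof. by apply/ereal_infP => _ [s [s0 _] <-]; rewrite lee_fin. Qed.

Lemma critical_dim_nonincreasing W (eps eps' : R) : (eps <= eps')%R ->
  critical_dim u W eps' <= critical_dim u W eps.
Proof.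
move=> ee; apply/ereal_infP => _ [s [s0 sm] <-]; apply: ereal_inf_lbound.
exists s => //; split => //; apply: (small_le smallP (k := 0) _ ee _ sm) => //.
move=> p _ _; rewrite /dim_weight leeN2 lee_wpmul2l ?lee_fin//.
exact: birkhoff_sup_le.
Qed.

Lemma dimension_cvg W : cvg (critical_dim u W eps @[eps --> (0%R : R)^'+]).
Proof.
apply: nonincreasing_at_right_is_cvge; near=> d => e e' _ _.
exact: critical_dim_nonincreasing.
Unshelve. all: by end_near. Qed.

Lemma critical_dim_le_dimension W (eps : R) : (0 < eps)%R ->
  critical_dim u W eps <= dimension u W.
Proof.
move=> e0; apply: lime_ge; first exact: dimension_cvg.
apply: (near_right0 e0) => e' e'0 /ltW; exact: critical_dim_nonincreasing.
Qed.

Lemma dimension_le W (s : R) : (0 <= s)%R ->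
  (forall eps, (0 < eps)%R -> small W (dim_weight u s eps) eps) ->
  dimension u W <= s%:E.
Proof.
move=> s0 sm; apply: lime_le; first exact: dimension_cvg.
apply: (near_right0 ltr01) => e e0 _; apply: ereal_inf_lbound.
by exists s => //; split => //; exact: sm.
Qed.

Lemma dimension_ge0 W : 0 <= dimension u W.
Proof.
exact: le_trans (critical_dim_ge0 _ _) (critical_dim_le_dimension _ ltr01).
Qed.

(** A negative pressure makes the set small at some scale, perhaps much smaller
    than [eps]; smallness then passes to [eps] because the weights
    [dim_weight u s] decrease as the scale grows. *)
Lemma pressure_lt0_small W (s eps : R) : (0 <= s)%R -> P s W < 0 ->
  (0 < eps)%R -> small W (dim_weight u s eps) eps.
Proof.
move=> s0 Ps e0.
have [eta eta0 Peta] : exists2 eta : R, (0 < eta)%R & P s W + eta%:E < 0.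
  move: Ps; case: (P s W) => [p||] //; last by exists 1%R.
  by rewrite lte_fin => p0; exists (- p / 2)%R; rewrite -?EFinD ?lte_fin; lra.
have [d d0 h] := critical_pressure_le_pressure s eta0.
pose e := Num.min eps (d / 2)%R.
have e0' : (0 < e)%R by rewrite lt_min e0 divr_gt0.
have ed : (e < d)%R by rewrite gt_min; apply/orP; right; lra.
have ee : (e <= eps)%R by rewrite ge_min lexx.
have /critical_pressure_lt sm := le_lt_trans (h W _ e0' ed) Peta.
apply: (small_le smallP (k := 0) _ ee _ sm) => // -[y n] _ _.
rewrite /dim_weight /pressure_weight /= mulr0 oppr0 add0e.
have := birkhoff_sup_ge (fun x => - s * u x)%R
  (@bowen_ball_self _ _ T n _ y e0').
apply: le_trans; rewrite birkhoff_sumZ mulNr EFinN leeN2 EFinM.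
rewrite lee_wpmul2l ?lee_fin//.
exact/birkhoff_sup_ge/bowen_ball_self.
Qed.

Variable Z : set X.
Hypothesis Z_nonempty : Z !=set0.
Hypothesis Z_averages : forall x, Z x -> exists k : nat,
  forall n, (k <= n)%N -> (n%:R * k.+1%:R^-1 <= S n x <= n%:R * k.+1%:R)%R.

(** On these pieces of [Z] the bounds on Birkhoff sums are uniform. *)
Let Zs (k : nat) : set X := [set x | Z x /\ forall n, (k <= n)%N ->
  (n%:R * k.+1%:R^-1 <= S n x <= n%:R * k.+1%:R)%R].

Let ZsE : Z = \bigcup_k Zs k.
Proof.
apply/seteqP; split=> [x Zx|x [k _ []]//].
by have [k hk] := Z_averages Zx; exists k.
Qed.

Let Zs_sub k : Zs k `<=` Z. Proof. by move=> x []. Qed.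

(** On each piece the pressure at [s + d] is at most [- d / (k + 1)], hence
    negative, so the piece is small for the exponent [s + d]; a countable union
    of small sets is small. *)
Lemma dimension_le_of_pressure (s : R) : (0 <= s)%R -> P s Z <= 0 ->
  dimension u Z <= s%:E.
Proof.
move=> s0 Ps; apply/lee_addgt0Pr => d d0; rewrite -EFinD.
have sd0 : (0 <= s + d)%R by rewrite addr_ge0// ltW.
apply: dimension_le => // e e0; rewrite ZsE; apply: (small_bigcup smallP) => k.
apply: pressure_lt0_small => //.
have /le_lt_trans : P (s + d)%R (Zs k) <= P s (Zs k) + (- (d / k.+1%:R))%:E.
  apply: (@pressure_compare _ _ _ k) => x n [_ h] /h /andP[h1 _].
  by have := ler_wpM2l (ltW d0) h1; move: (k.+1%:R^-1)%R => v; lra.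
apply; apply: (@le_lt_trans _ _ (0 + (- (d / k.+1%:R))%:E)).
  by rewrite leeD2r// (le_trans (pressure_subset _ (@Zs_sub k))).
by rewrite add0e lte_fin oppr_lt0 divr_gt0.
Qed.

(** On each piece [u(y, n, eps)] is eventually nonnegative, so the smallness
    obtained for some exponent [s' < s] holds for [s]; replacing
    [- s u(y, n, eps)] by the supremum of [S_n (- s u)] costs at most
    [n * (2 * s * e1)]. *)
Lemma pressure_le0_of_dimension (s : R) : dimension u Z < s%:E -> P s Z <= 0.
Proof.
move=> Ds; have s0 : (0 < s)%R.
  by have := le_lt_trans (dimension_ge0 Z) Ds; rewrite lte_fin.
rewrite ZsE; apply: pressure_bigcup => k; apply/lee_addgt0Pr => eta eta0.
rewrite add0e; set e1 := (eta / (2 * s))%R.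
have e10 : (0 < e1)%R by rewrite divr_gt0// mulr_gt0.
have etaE : eta = (2 * (s * e1))%R by rewrite /e1; field; rewrite gt_eqF.
have [d d0 hd] := unif_continuous_mdist u_uc e10.
apply: (pressure_le d0) => e e0 ed; apply: critical_pressure_le.
have /ereal_inf_ltP[_ [s' [s'0 sm] <-]] :=
  le_lt_trans (critical_dim_le_dimension _ e0) Ds.
rewrite lte_fin => s's.
apply: (small_le smallP (k := k) _ (lexx e) _ sm) => //.
move=> [y n] /= kn [x [[_ hx] yx]].
rewrite /dim_weight /pressure_weight /=.
have htu x1 x2 : (mdist x1 x2 < d)%R ->
    (`|- s * u x1 - - s * u x2| <= s * e1)%R.
  by move=> /hd h; rewrite -mulrBr normrM normrN (gtr0_norm s0) ler_wpM2l// ltW.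
have := birkhoff_sup_leD T n y htu (ltW ed); rewrite birkhoff_sumZ => hB'.
have hu := birkhoff_sup_leD T n y hd (ltW ed).
have hu0 : 0 <= birkhoff_sup T u n e y.
  apply: le_trans (birkhoff_sup_ge u yx); rewrite lee_fin.
  by have /andP[h _] := hx _ kn; rewrite (le_trans _ h)// mulr_ge0.
apply: (le_trans (leeD2l _ hB')).
have h1 : s'%:E * birkhoff_sup T u n e y <= (s * (S n y + n%:R * e1))%:E.
  rewrite EFinM (le_trans (lee_wpmul2r hu0 (y := s%:E) _))
    ?lee_fin ?(ltW s's)//.
  by rewrite lee_wpmul2l// lee_fin ltW.
rewrite leeNr (le_trans h1)// -EFinD -EFinN lee_fin etaE.
by rewrite le_eqVlt; apply/orP; left; apply/eqP; ring.
Qed.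

(** The pressure at [0] is nonnegative on a nonempty piece, where moreover
    [S_n u <= n * (k + 1)]. *)
Lemma pressure_gtNy (s : R) : -oo < P s Z.
Proof.
have [x Zx] := Z_nonempty; have := Zx; rewrite {1}ZsE => -[k _ Zkx].
have : P 0%R (Zs k) <= P s (Zs k) + (`|s| * k.+1%:R)%:E.
  apply: (@pressure_compare _ _ _ k) => y n [_ h] kn.
  have /andP[h1 h2] := h _ kn.
  have S0 : (0 <= S n y)%R by rewrite (le_trans _ h1)// mulr_ge0.
  rewrite subr0 mulrCA (le_trans (ler_wpM2r S0 (ler_norm s)))//.
  by rewrite ler_wpM2l.
move=> /(le_trans (pressure0_ge0 _)) => /(_ (ex_intro _ x Zkx)) h.
apply: (lt_le_trans _ (pressure_subset _ (@Zs_sub k))).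
by rewrite ltNge leeNy_eq; apply/negP => /eqP PE; move: h; rewrite PE.
Qed.

(** For [s < 0], on a nonempty piece the pressure at [s] exceeds the one at [0],
    which is nonnegative, by at least [- s / (k + 1)]. *)
Lemma pressure_le0_ge0 (s : R) : P s Z <= 0 -> (0 <= s)%R.
Proof.
move=> Ps; rewrite leNgt; apply/negP => s0.
have [x Zx] := Z_nonempty; have := Zx; rewrite {1}ZsE => -[k _ Zkx].
have : P 0%R (Zs k) <= P s (Zs k) + (s / k.+1%:R)%:E.
  apply: (@pressure_compare _ _ _ k) => y n [_ h] kn.
  have /andP[h1 _] := h _ kn.
  by rewrite subr0 mulrCA ler_wnM2l// ltW.
move=> /(le_trans (pressure0_ge0 _)) => /(_ (ex_intro _ x Zkx)).
rewrite leNgt => /negP; apply.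
apply: (@le_lt_trans _ _ (0 + (s / k.+1%:R)%:E)).
  by rewrite leeD2r// (le_trans (pressure_subset _ (@Zs_sub k))).
by rewrite add0e lte_fin pmulr_llt0// invr_gt0.
Qed.

Lemma pressure_lipschitz (s t b : R) : (s <= t)%R ->
  (forall x, Z x -> exists k : nat,
     forall n, (k <= n)%N -> (S n x <= n%:R * b)%R) ->
  P s Z <= P t Z + ((t - s) * b)%:E.
Proof.
move=> st hZ.
have -> : Z = \bigcup_k [set x | Z x /\
    forall n, (k <= n)%N -> (S n x <= n%:R * b)%R].
  apply/seteqP; split=> [x Zx|x [k _ []]//].
  by have [k hk] := hZ x Zx; exists k.
apply: pressure_compare_bigcup => k x n [_ h] /h hn.
by rewrite mulrCA ler_wpM2l// subr_ge0.
Qed.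

Lemma pressure_decay (s t a : R) : (s <= t)%R ->
  (forall x, Z x -> exists k : nat,
     forall n, (k <= n)%N -> (n%:R * a <= S n x)%R) ->
  P t Z <= P s Z + (- ((t - s) * a))%:E.
Proof.
move=> st hZ.
have -> : Z = \bigcup_k [set x | Z x /\
    forall n, (k <= n)%N -> (n%:R * a <= S n x)%R].
  apply/seteqP; split=> [x Zx|x [k _ []]//].
  by have [k hk] := hZ x Zx; exists k.
apply: pressure_compare_bigcup => k x n [_ h] /h hn.
by rewrite -mulNr opprB mulrCA ler_wnM2l// subr_le0.
Qed.

(** Both formulas hold because [p s <= 0] is equivalent to [D <= s] except
    possibly at [s = D], where one implication may fail. *)
Lemma dimension_eq_sup :
  dimension u Z = ereal_sup [set s%:E | s in [set s : R | 0 < P s Z]].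
Proof.
apply/eqP; rewrite eq_le; apply/andP; split; last first.
  apply: ge_ereal_sup => _ [s /= Ps <-]; rewrite leNgt; apply/negP.
  by move/pressure_le0_of_dimension; rewrite leNgt Ps.
apply: lee_real => r hr; rewrite leNgt; apply/negP => rD.
suff Pr : 0 < P r Z.
  by move: hr; apply/negP; rewrite -leNgt; apply: ereal_sup_ubound; exists r.
rewrite ltNge; apply/negP => Pr; move: rD; apply/negP; rewrite -leNgt.
exact: dimension_le_of_pressure (pressure_le0_ge0 Pr) Pr.
Qed.

Lemma dimension_eq_inf :
  dimension u Z = ereal_inf [set s%:E | s in [set s : R | P s Z <= 0]].
Proof.
apply/eqP; rewrite eq_le; apply/andP; split.
  apply/ereal_infP => _ [s /= Ps <-].
  exact: dimension_le_of_pressure (pressure_le0_ge0 Ps) Ps.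
apply: lee_real => r /pressure_le0_of_dimension Pr.
by apply: ereal_inf_lbound; exists r.
Qed.

(** [p] is nonpositive after [D] and positive before it; the Lipschitz bound
    carries both signs to [D] itself. *)
Lemma pressure_dimension (b s0 : R) :
  (forall x, Z x -> exists k : nat,
     forall n, (k <= n)%N -> (S n x <= n%:R * b)%R) ->
  dimension u Z = s0%:E -> P s0 Z = 0.
Proof.
move=> hb D0; set c : R := (`|b| + 1)%R.
have c0 : (0 < c)%R by rewrite ltr_wpDl.
have hc x : Z x -> exists k : nat,
    forall n, (k <= n)%N -> (S n x <= n%:R * c)%R.
  move=> /hb[k hk]; exists k => n kn.
  rewrite (le_trans (hk _ kn))// ler_wpM2l//.
  by rewrite (le_trans (ler_norm _))// lerDl.
have cE eta : ((eta / c) * c = eta)%R by rewrite divfK// gt_eqF.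
apply/eqP; rewrite eq_le; apply/andP; split; apply/lee_addgt0Pr => eta eta0.
  have ec : (0 < eta / c)%R by rewrite divr_gt0.
  have le0 : (s0 <= s0 + eta / c)%R by rewrite lerDl ltW.
  apply: (le_trans (pressure_lipschitz le0 hc)); rewrite addrAC subrr add0r cE.
  by rewrite leeD2r// pressure_le0_of_dimension// D0 lte_fin ltrDl.
have ec : (0 < eta / c)%R by rewrite divr_gt0.
have le0 : (s0 - eta / c <= s0)%R by rewrite gerBl ltW.
have := pressure_lipschitz le0 hc; rewrite subKr cE.
apply: le_trans; rewrite leNgt; apply/negP => /ltW Pl.
have := dimension_le_of_pressure (pressure_le0_ge0 Pl) Pl.
by rewrite D0 lee_fin leNgt gtrBl ec.
Qed.

Lemma pressure_decreasing (a s t : R) : (0 < a)%R ->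
  (forall x, Z x -> exists k : nat,
     forall n, (k <= n)%N -> (n%:R * a <= S n x)%R) ->
  (s < t)%R -> P t Z < +oo -> P t Z < P s Z.
Proof.
move=> a0 ha st; have := pressure_decay (ltW st) ha.
have d0 : (0 < (t - s) * a)%R by rewrite mulr_gt0// subr_gt0.
have := pressure_gtNy s; case: (P s Z) => [p||] // _ h Pt.
by rewrite (le_lt_trans h)// -EFinD lte_fin gtrDl oppr_lt0.
Qed.

Lemma dimension_lty (a : R) : (0 < a)%R ->
  (forall x, Z x -> exists k : nat,
     forall n, (k <= n)%N -> (n%:R * a <= S n x)%R) ->
  P 0%R Z < +oo -> dimension u Z < +oo.
Proof.
move=> a0 ha hfin.
have [h h0 Ph] : exists2 h : R, (0 <= h)%R & P 0%R Z <= h%:E.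
  exists (fine (P 0%R Z)); first by rewrite fine_ge0 ?pressure0_ge0.
  by rewrite fineK// ge0_fin_numE ?pressure0_ge0.
have ha0 : (0 <= h / a)%R by rewrite divr_ge0// ltW.
apply: (@le_lt_trans _ _ (h / a)%:E); last exact: ltry.
apply: dimension_le_of_pressure => //.
apply: (le_trans (pressure_decay ha0 ha)).
rewrite subr0 divfK ?gt_eqF//.
by rewrite (le_trans (leeD2r _ Ph))// -EFinD subrr.
Qed.

End CriticalExponents.

(** * The Bowen equation *)
Section BowenEquation.
Context {R : realType} {X : metricType R}.
Variables (T : X -> X) (u : X -> R) (Z : set X).
Variable small : set X -> (X * nat -> \bar R) -> R -> Prop.
Hypothesis smallP : smallness T small.
Hypothesis u_uc : unif_continuous u.
Hypothesis Z_nonempty : Z !=set0.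
Hypothesis Z_averages : forall x, Z x ->
  0 < lower_average T u x /\
  lower_average T u x <= upper_average T u x /\ upper_average T u x < +oo.

(** The quantities are passed as [D], [h] and [p] with equations, so that the
    result applies to any definitions that agree with the pressure and dimension
    of the given notion of smallness. *)
Lemma bowen_equation (D h : \bar R) (p : R -> \bar R) :
  D = dimension T small u Z ->
  h = pressure T small (fun=> 0%R) Z ->
  (forall s, p s = pressure T small (fun x => - s * u x)%R Z) ->
  (D = ereal_sup [set s%:E | s in [set s : R | 0 < p s]] /\
   D = ereal_inf [set s%:E | s in [set s : R | p s <= 0]]) /\
  (h < +oo ->
    (forall beta : R, (forall x, Z x -> upper_average T u x <= beta%:E) ->
       D < +oo -> exists s0 : R, D = s0%:E /\ p s0 = 0) /\
    (forall alpha : R, (0 < alpha)%R ->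
       (forall x, Z x -> alpha%:E <= lower_average T u x) ->
       (forall s t : R, (0 <= s)%R -> (s < t)%R -> p t < p s) /\
       (forall s t : R, (s < t)%R -> p t < +oo -> p t < p s) /\
       (forall s t : R, p s = 0 -> p t = 0 -> s = t)) /\
    (forall alpha beta : R, (0 < alpha)%R ->
       (forall x, Z x -> alpha%:E <= lower_average T u x /\
                         upper_average T u x <= beta%:E) ->
       exists s0 : R, D = s0%:E /\ (forall s : R, p s = 0 <-> s = s0))).
Proof.
move=> DE hE pE.
have {}pE : p = fun s => pressure T small (fun x => - s * u x)%R Z.
  exact/funext.
have {}hE : h = p 0%R.
  rewrite hE pE; congr (pressure _ _ _ _).
  by apply/funext => x; rewrite oppr0 mul0r.
have avg x : Z x -> exists k : nat, forall n, (k <= n)%N ->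
    (n%:R * k.+1%:R^-1 <= birkhoff_sum T u n x <= n%:R * k.+1%:R)%R.
  by move=> /Z_averages[lo [_ up]]; exact: averages_between.
have upb (beta : R) : (forall x, Z x -> upper_average T u x <= beta%:E) ->
    forall x, Z x -> exists k : nat, forall n, (k <= n)%N ->
      (birkhoff_sum T u n x <= n%:R * (beta + 1))%R.
  move=> hb x /hb hx; apply: upper_average_lt; apply: (le_lt_trans hx).
  by rewrite lte_fin ltrDl.
have lob (alpha : R) : (0 < alpha)%R ->
    (forall x, Z x -> alpha%:E <= lower_average T u x) ->
    forall x, Z x -> exists k : nat, forall n, (k <= n)%N ->
      (n%:R * (alpha / 2) <= birkhoff_sum T u n x)%R.
  move=> a0 ha x /ha hx; apply: lower_average_gt; apply: lt_le_trans hx.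
  by rewrite lte_fin; lra.
have sol (beta : R) : (forall x, Z x -> upper_average T u x <= beta%:E) ->
    D < +oo -> exists s0 : R, D = s0%:E /\ p s0 = 0.
  move=> hb Dfin.
  have Dnum : D \is a fin_num.
    by rewrite ge0_fin_numE// DE dimension_ge0.
  exists (fine D); rewrite fineK//; split => //; rewrite pE.
  apply: (pressure_dimension smallP u_uc Z_nonempty avg (upb _ hb)).
  by rewrite fineK.
have decr (alpha : R) : (0 < alpha)%R ->
    (forall x, Z x -> alpha%:E <= lower_average T u x) ->
    forall s t : R, (s < t)%R -> p t < +oo -> p t < p s.
  move=> a0 ha s t; rewrite pE => st pt.
  apply: (pressure_decreasing smallP u_uc Z_nonempty avg _ (lob _ a0 ha)) => //.
  by rewrite divr_gt0.
have uniq (alpha : R) : (0 < alpha)%R ->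
    (forall x, Z x -> alpha%:E <= lower_average T u x) ->
    forall s t : R, p s = 0 -> p t = 0 -> s = t.
  move=> a0 ha s t ps pt; apply/eqP; case: (ltgtP s t) => // st.
    by have := decr _ a0 ha _ _ st; rewrite ps pt ltxx => ->.
  by have := decr _ a0 ha _ _ st; rewrite ps pt ltxx => ->.
split.
  rewrite DE pE; split; [exact: dimension_eq_sup|exact: dimension_eq_inf].
rewrite hE => hfin; split; [exact: sol|split].
  move=> alpha a0 ha; split; last first.
    by split; [exact: decr a0 ha|exact: uniq a0 ha].
  move=> s t s0 st; apply: (decr _ a0 ha) => //; move: hfin; rewrite pE.
  apply: le_lt_trans.
  have t0 : (0 <= t)%R by rewrite (le_trans s0)// ltW.
  apply: (le_trans (pressure_decay smallP u_uc t0 (lob _ a0 ha))).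
  rewrite -[leRHS]adde0 leeD2l// lee_fin oppr_le0 mulr_ge0//.
    by rewrite subr_ge0.
  by rewrite divr_ge0// ltW.
move=> alpha beta a0 hab.
have ha x : Z x -> alpha%:E <= lower_average T u x by move=> /hab[].
have hb x : Z x -> upper_average T u x <= beta%:E by move=> /hab[].
have Dfin : D < +oo.
  rewrite DE.
  apply: (dimension_lty smallP u_uc Z_nonempty avg _ (lob _ a0 ha)).
    by rewrite divr_gt0.
  by move: hfin; rewrite pE.
have [s0 [Ds ps]] := sol _ hb Dfin; exists s0; split => // s; split=> [p0|->//].
exact: uniq a0 ha _ _ p0 ps.
Qed.

End BowenEquation.

(** * Powers of two and sums of weights *)
Section Pow2.
Context {R : realType}.
Implicit Types x y : \bar R.

Let ln2_gt0 : (0 < ln (2 : R))%R. Proof. by rewrite ln_gt0// ltr1n. Qed.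

Lemma pow2_ge0 x : 0 <= pow2 x. Proof. exact: expeR_ge0. Qed.

Lemma le_pow2 x y : x <= y -> pow2 x <= pow2 y.
Proof. by move=> xy; rewrite /pow2 lee_expeR lee_wpmul2l// lee_fin ltW. Qed.

Lemma pow20 : pow2 (0 : \bar R) = 1.
Proof. by rewrite /pow2 mule0 expeR0. Qed.

Lemma pow2D (c : R) x : pow2 (c%:E + x) = pow2 c%:E * pow2 x.
Proof. by rewrite /pow2 muleDr// ?fin_num_adde_defr// expeRD. Qed.

Lemma log2K x : log2 (pow2 x) = x.
Proof. by rewrite /log2 /pow2 expeRK muleA -EFinM mulVf ?mul1e// gt_eqF. Qed.

Lemma le_log2 x y : 0 <= x -> x <= y -> log2 x <= log2 y.
Proof.
move=> x0 xy; rewrite /log2 lee_wpmul2l//.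
  by rewrite lee_fin invr_ge0 ltW.
by rewrite lee_lne// in_itv/= leey ?andbT// (le_trans x0).
Qed.

Lemma le_pow2_unbounded (K a : R) : (0 < a)%R ->
  exists N : nat, forall n, (N <= n)%N -> K%:E < pow2 (n%:R * a)%:E.
Proof.
move=> a0; exists (Num.truncn (K / (ln 2 * a))).+1 => n Nn.
have la : (0 < ln 2 * a :> R)%R by rewrite mulr_gt0.
apply: (lt_le_trans _ (expeR_ge1Dx _)); rewrite -EFinM -EFinD lte_fin.
have : (K / (ln 2 * a) < n%:R)%R.
  by rewrite (lt_le_trans (truncnS_gt _))// ler_nat.
by rewrite ltr_pdivrMr// mulrCA; lra.
Qed.

Lemma le_pow2_surj (K : R) : exists c : R, K%:E <= pow2 c%:E.
Proof.
have [N h] := le_pow2_unbounded K (ltr01 : (0 < 1 :> R)%R).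
by exists (N%:R * 1)%R; exact: ltW (h _ (leqnn N)).
Qed.

End Pow2.

Section Sums.
Context {R : realType} {I : choiceType}.
Implicit Types (A B : set I) (a b : I -> \bar R).

Lemma esum_subset A B a : A `<=` B -> \esum_(i in A) a i <= \esum_(i in B) a i.
Proof.
move=> AB; apply: le_ereal_sup => _ [F [Ffin FA] <-]; exists F => //.
by split => //; exact: subset_trans AB.
Qed.

Lemma esum_ge1 A a i : A i -> 0 <= a i -> a i <= \esum_(j in A) a j.
Proof.
by move=> Ai a0; rewrite -{1}(esum_set1 a0); apply: esum_subset => _ ->.
Qed.

Lemma esum_pow2D A (c : R) a :
  \esum_(i in A) pow2 (c%:E + a i) <= pow2 c%:E * \esum_(i in A) pow2 (a i).
Proof.
apply: ge_ereal_sup => _ [F [Ffin FA] <-].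
rewrite (eq_fsbigr (fun i => pow2 c%:E * pow2 (a i))); last first.
  by move=> i _; rewrite pow2D.
rewrite -ge0_mule_fsumr; last by move=> i; exact: pow2_ge0.
by rewrite lee_wpmul2l ?pow2_ge0//; apply: ereal_sup_ubound; exists F.
Qed.

Lemma esum_bigcup_le (A : nat -> set I) a : (forall i, 0 <= a i) ->
  \esum_(i in \bigcup_k A k) a i <= \sum_(0 <= k <oo) \esum_(i in A k) a i.
Proof.
move=> a0; rewrite seqDU_bigcup_eq esum_bigcupT//.
rewrite -nneseries_esumT; last by move=> k; apply: esum_ge0.
apply: lee_nneseries => k _; first by move=> _; exact: esum_ge0.
by apply: esum_subset; exact: subset_seqDU.
Qed.

End Sums.

(** * The lower theory *)
Section LowerSmallness.
Context {R : realType} {X : metricType R} (T : X -> X).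
Implicit Types (W : set X) (w : X * nat -> \bar R).

(** [W] has covers by long Bowen balls of arbitrarily small total weight: the
    Caratheodory-type outer measure with these weights vanishes on [W]. *)
Definition null W w (eps : R) : Prop := forall (N : nat) (eta : R),
  (0 < eta)%R -> exists2 C, bowen_covers T W N eps C &
    \esum_(p in C) pow2 (w p) < eta%:E.

Lemma null_le W W' w w' (eps eps' : R) (k : nat) :
  W' `<=` W -> (eps <= eps')%R ->
  (forall p, (k <= p.2)%N -> W' `&` bowen_ball T p.2 eps p.1 !=set0 ->
     w' p <= w p) ->
  null W w eps -> null W' w' eps'.
Proof.
move=> sub ee ww nW N eta eta0.
have [C [Cc CN CW] Ceta] := nW (maxn N k) _ eta0.
pose C' := C `&` [set p | W' `&` bowen_ball T p.2 eps p.1 !=set0].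
exists C'; first split.
- by apply: sub_countable Cc; apply: subset_card_le => p [].
- by move=> p [/CN]; rewrite geq_max => /andP[].
- move=> x W'x; have [p Cp px] := CW _ (sub _ W'x); exists p.
    by split => //; exists x.
  exact: bowen_ball_le ee _ px.
apply: le_lt_trans Ceta.
apply: (@le_trans _ _ (\esum_(p in C') pow2 (w p))); last first.
  by apply: esum_subset => p [].
apply: le_esum => p [/CN + hp]; rewrite geq_max => /andP[_ kp].
by apply: le_pow2; exact: ww.
Qed.

Lemma null_bigcup (Ws : nat -> set X) w (eps : R) :
  (forall i, null (Ws i) w eps) -> null (\bigcup_i Ws i) w eps.
Proof.
move=> nWs N eta eta0.
have /choice[C hC] : forall i, exists C, bowen_covers T (Ws i) N eps C /\
    \esum_(p in C) pow2 (w p) < ((eta / 2) / (2 ^ i.+1)%:R)%:E.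
  move=> i; have e0 : (0 < (eta / 2) / (2 ^ i.+1)%:R)%R.
    by rewrite !divr_gt0// ltr0n expn_gt0.
  by have [C ? ?] := nWs i N _ e0; exists C.
exists (\bigcup_i C i); first split.
- by apply: bigcup_countable => // i _; have [[]] := hC i.
- by move=> p [i _ Cp]; have [[_ + _] _] := hC i; apply.
- move=> x [i _ Wx]; have [[_ _ /(_ _ Wx)[p Cp px]] _] := hC i.
  by exists p => //; exists i.
apply: (@le_lt_trans _ _ (eta / 2)%:E); last by rewrite lte_fin; lra.
apply: (le_trans (esum_bigcup_le _ _)); first by move=> p; exact: pow2_ge0.
have e0 : (0 <= eta / 2)%R by rewrite divr_ge0// ltW.
apply: le_trans (epsilon_trick0 xpredT e0); apply: lee_nneseries => i _.
  by move=> _; apply: esum_ge0 => p _; exact: pow2_ge0.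
by apply/ltW; case: (hC i).
Qed.

(** A nonempty set needs at least one ball, of weight at least [2 ^ 0]. *)
Lemma null_growing W w (eps a : R) : W !=set0 -> (0 < a)%R ->
  (forall p, (p.2%:R * a)%:E <= w p) -> ~ null W w eps.
Proof.
move=> [x Wx] a0 aw /(_ 0%N 1%R ltr01)[C [_ _ /(_ _ Wx)[p Cp _]]].
apply/negP; rewrite -leNgt.
apply: le_trans (esum_ge1 Cp _); last exact: pow2_ge0.
rewrite -pow20; apply: le_pow2; apply: le_trans (aw p).
by rewrite lee_fin mulr_ge0// ltW.
Qed.

Lemma null_smallness : smallness T null.
Proof. by split; [exact: null_le|exact: null_bigcup|exact: null_growing]. Qed.

(** The infima increase with the minimal length [N], so the limit vanishes
    exactly when all of them do. *)
Lemma cover_limit_eq0 W w (eps : R) :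
  limn (fun N => ereal_inf
    [set \esum_(p in C) pow2 (w p) | C in bowen_covers T W N eps]) = 0
  <-> null W w eps.
Proof.
set m := fun N => _.
have m0 N : 0 <= m N.
  by apply/ereal_infP => _ [C _ <-]; apply: esum_ge0 => p _; exact: pow2_ge0.
have -> : limn m = ereal_sup (range m).
  apply/cvg_lim => //; apply: ereal_nondecreasing_cvgn => N N' NN'.
  apply: ereal_inf_le_tmp => _ [C [Cc CN CW] <-]; exists C => //; split => //.
  by move=> p /CN; exact: leq_trans.
split=> [sup0 N eta eta0|nW].
  have /ereal_inf_ltP[_ [C CW <-] Ceta] : m N < eta%:E.
    apply: (@le_lt_trans _ _ 0); last by rewrite lte_fin.
    by rewrite -sup0; apply: ereal_sup_ubound; exists N.
  by exists C.
apply/eqP; rewrite eq_le; apply/andP; split; last first.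
  by apply: le_trans (m0 0%N) _; apply: ereal_sup_ubound; exists 0%N.
apply: ge_ereal_sup => _ [N _ <-]; apply/lee_addgt0Pr => eta eta0.
have [C CW Ceta] := nW N _ eta0; rewrite add0e.
apply: ge_ereal_inf; exists (\esum_(p in C) pow2 (w p)); first by exists C.
exact: ltW.
Qed.

Arguments cover_limit_eq0 : clear implicits.

Lemma lower_pressure_atE f W (eps : R) :
  lower_pressure_at T f W eps = critical_pressure T null f W eps.
Proof.
rewrite /lower_pressure_at /critical_pressure; congr (ereal_inf (_ @` _)).
by apply/seteqP; split=> r /= /(cover_limit_eq0 _ _ _).
Qed.

Lemma lower_BS_dim_atE u W (eps : R) :
  lower_BS_dim_at T u W eps = critical_dim T null u W eps.
Proof.
rewrite /lower_BS_dim_at /critical_dim; congr (ereal_inf (_ @` _)).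
by apply/seteqP; split=> s /= [s0 /(cover_limit_eq0 _ _ _)].
Qed.

Lemma lower_pressureE f W : lower_pressure T f W = pressure T null f W.
Proof.
rewrite /lower_pressure /pressure.
suff -> : lower_pressure_at T f W = critical_pressure T null f W by [].
by apply/funext => eps; exact: lower_pressure_atE.
Qed.

Lemma lower_BS_dimE u W : lower_BS_dim T u W = dimension T null u W.
Proof.
rewrite /lower_BS_dim /dimension.
suff -> : lower_BS_dim_at T u W = critical_dim T null u W by [].
by apply/funext => eps; exact: lower_BS_dim_atE.
Qed.

End LowerSmallness.

(** * The upper theory *)
Section UpperSmallness.
Context {R : realType} {X : metricType R} (T : X -> X).
Implicit Types (W : set X) (w : X * nat -> \bar R).

(** At every large time [n], some cover of [W] by Bowen balls of that length has
    total weight bounded independently of [n]. *)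
Definition capped W w (eps : R) : Prop := exists (K : R) (N : nat),
  forall n, (N <= n)%N -> exists2 E, bowen_covers_at T W n eps E &
    \esum_(x in E) pow2 (w (x, n)) <= K%:E.

(** A countable union of capped sets need not be capped; the countable
    decomposition in the definition of the upper quantities restores countable
    stability. *)
Definition scapped W w (eps : R) : Prop := exists2 Ws : nat -> set X,
  W `<=` \bigcup_i Ws i & forall i, capped (Ws i) w eps.

Lemma capped_le W W' w w' (eps eps' : R) (k : nat) :
  W' `<=` W -> (eps <= eps')%R ->
  (forall p, (k <= p.2)%N -> W' `&` bowen_ball T p.2 eps p.1 !=set0 ->
     w' p <= w p) ->
  capped W w eps -> capped W' w' eps'.
Proof.
move=> sub ee ww [K [N cW]]; exists K, (maxn N k) => n.
rewrite geq_max => /andP[/cW[E [Ec EW] EK] kn].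
pose E' := E `&` [set x | W' `&` bowen_ball T n eps x !=set0].
exists E'; first split.
- by apply: sub_countable Ec; apply: subset_card_le => x [].
- move=> x W'x; have [y Ey yx] := EW _ (sub _ W'x); exists y.
    by split => //; exists x.
  exact: bowen_ball_le ee _ yx.
apply: le_trans EK.
apply: (@le_trans _ _ (\esum_(x in E') pow2 (w (x, n)))); last first.
  by apply: esum_subset => x [].
by apply: le_esum => x [_ hx]; apply: le_pow2; exact: ww.
Qed.

Lemma scapped_le W W' w w' (eps eps' : R) (k : nat) :
  W' `<=` W -> (eps <= eps')%R ->
  (forall p, (k <= p.2)%N -> W' `&` bowen_ball T p.2 eps p.1 !=set0 ->
     w' p <= w p) ->
  scapped W w eps -> scapped W' w' eps'.
Proof.
move=> sub ee ww [Ws WWs cWs]; exists (fun i => Ws i `&` W').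
  by move=> x W'x; have [i _ Wx] := WWs _ (sub _ W'x); exists i.
move=> i; apply: (@capped_le _ _ _ _ _ _ k _ ee _ (cWs i)).
  by move=> x [].
by move=> p kp [x [[_ W'x] px]]; apply: ww => //; exists x.
Qed.

Lemma scapped_bigcup (Ws : nat -> set X) w (eps : R) :
  (forall i, scapped (Ws i) w eps) -> scapped (\bigcup_i Ws i) w eps.
Proof.
move=> /(_ _)/cid2-/all_sig2[V WV cV].
exists (fun m => let ij := odflt (0, 0)%N (unpickle m) in V ij.1 ij.2).
  move=> x [i _ /WV[j _ Vx]]; exists (pickle (i, j)) => //=.
  by rewrite pickleK.
by move=> m; exact: cV.
Qed.

(** One point costs at least [2 ^ (n * a)], which is unbounded in [n]. *)
Lemma scapped_growing W w (eps a : R) : W !=set0 -> (0 < a)%R ->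
  (forall p, (p.2%:R * a)%:E <= w p) -> ~ scapped W w eps.
Proof.
move=> [x Wx] a0 aw [Ws /(_ _ Wx)[i _ Wix] /(_ i)[K [N cW]]].
have [N' hN'] := le_pow2_unbounded K a0.
have [E [_ /(_ _ Wix)[y Ey _]]] := cW (maxn N N') (leq_maxl _ _).
apply/negP; rewrite -ltNge; apply: lt_le_trans (hN' _ (leq_maxr N N')) _.
apply: (le_trans (le_pow2 (aw (y, _)))).
by apply: (esum_ge1 (a := fun y => pow2 (w (y, _))) Ey); exact: pow2_ge0.
Qed.

Lemma scapped_smallness : smallness T scapped.
Proof.
by split; [exact: scapped_le|exact: scapped_bigcup|exact: scapped_growing].
Qed.

(** Bounded weights at level [r] mean that the sum at time [n] is at most
    [2 ^ (n * r + c)], and the term [c / n] disappears in the limit. *)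
Lemma capacity_pressure_le f W (r eps : R) :
  capped W (pressure_weight T f r eps) eps ->
  upper_capacity_pressure T f W eps <= r%:E.
Proof.
move=> [K [N cW]]; have [c Kc] := le_pow2_surj K.
apply/lee_addgt0Pr => eta eta0.
apply: (@limn_esup_le _ _ _ (maxn N (Num.truncn (c / eta)).+1)) => n.
rewrite geq_max => /andP[/cW[E EW EK] cn].
have n0 : (0 < n%:R :> R)%R by rewrite ltr0n (leq_trans _ cn).
have Sn : pressure_sum_at T f W n eps <= pow2 ((n%:R * r + c)%:E).
  apply: ge_ereal_inf; exists (\esum_(x in E) pow2 (birkhoff_sup T f n eps x)).
    by exists E.
  rewrite EFinD pow2D.
  apply: (@le_trans _ _ (pow2 (n%:R * r)%:E * \esum_(x in E)
      pow2 (pressure_weight T f r eps (x, n)))); last first.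
    by rewrite lee_wpmul2l ?pow2_ge0// (le_trans EK).
  rewrite -(_ : \esum_(x in E) pow2 ((n%:R * r)%:E +
      pressure_weight T f r eps (x, n)) = \esum_(x in E) _).
    exact: esum_pow2D.
  apply: eq_esum => x _; congr pow2.
  by rewrite /pressure_weight/= addeA -EFinD subrr add0e.
apply: (@le_trans _ _ ((n%:R^-1)%:E * (n%:R * r + c)%:E)).
  rewrite lee_wpmul2l ?lee_fin ?invr_ge0//.
  rewrite -[leRHS]log2K; apply: le_log2 Sn.
  by apply/ereal_infP => _ [? _ <-]; apply: esum_ge0 => ? _; exact: pow2_ge0.
rewrite -EFinM -EFinD lee_fin mulrDr mulKf ?gt_eqF// lerD2l mulrC.
rewrite ler_pdivrMr// mulrC -ler_pdivrMr//.
by rewrite ltW// (lt_le_trans (truncnS_gt _))// ler_nat.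
Qed.

Lemma capacity_pressure_lt f W (r eps : R) :
  upper_capacity_pressure T f W eps < r%:E ->
  capped W (pressure_weight T f r eps) eps.
Proof.
move=> /limn_esup_lt[N hN]; exists 1%R, N.+1 => n Nn.
have n0 : (0 < n%:R :> R)%R by rewrite ltr0n (leq_trans _ Nn).
have /ereal_inf_ltP[_ [E EW <-] Er] : pressure_sum_at T f W n eps <
    pow2 (n%:R * r)%:E.
  rewrite ltNge; apply/negP => /(le_log2 (pow2_ge0 _)); rewrite log2K => h.
  have := hN _ (ltnW Nn); apply/negP; rewrite -leNgt.
  have -> : r%:E = (n%:R^-1)%:E * (n%:R * r)%:E.
    by rewrite -EFinM mulKf ?gt_eqF.
  by rewrite lee_wpmul2l// lee_fin invr_ge0 ltW.
exists E => //; rewrite /pressure_weight/=.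
apply: (le_trans (esum_pow2D _ _ _)).
apply: (le_trans (lee_wpmul2l (pow2_ge0 _) (ltW Er))).
by rewrite -pow2D -EFinD addNr pow20.
Qed.

Lemma upper_pressure_atE f W (eps : R) :
  upper_pressure_at T f W eps = critical_pressure T scapped f W eps.
Proof.
apply/eqP; rewrite eq_le; apply/andP; split.
  apply/ereal_infP => _ [r [Ws WWs cWs] <-]; apply: ge_ereal_inf.
  eexists; first by exists Ws.
  by apply: ge_ereal_sup => _ [i _ <-]; exact: capacity_pressure_le.
apply: lee_real => r /ereal_inf_ltP[_ [Ws WWs <-] supr].
apply: critical_pressure_le; exists Ws => // i; apply: capacity_pressure_lt.
by apply: le_lt_trans supr; apply: ereal_sup_ubound; exists i.
Qed.

Lemma upper_pressureE f W : upper_pressure T f W = pressure T scapped f W.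
Proof.
rewrite /upper_pressure /pressure.
suff -> : upper_pressure_at T f W = critical_pressure T scapped f W by [].
by apply/funext => eps; exact: upper_pressure_atE.
Qed.

Lemma capacity_dim_le u W (s eps : R) : (0 <= s)%R ->
  capped W (dim_weight T u s eps) eps -> BS_capacity_dim T u W eps <= s%:E.
Proof.
move=> s0 [K [N cW]]; apply: ereal_inf_lbound; exists s => //; split => //.
apply: (@le_lt_trans _ _ K%:E); last exact: ltry.
apply: (@limn_esup_le _ _ _ N) => n /cW[E EW EK].
apply: ge_ereal_inf.
exists (\esum_(x in E) pow2 (- (s%:E * birkhoff_sup T u n eps x))) => //.
by exists E.
Qed.

Lemma capacity_dim_lt u W (s eps : R) : BS_capacity_dim T u W eps < s%:E ->
  exists2 s' : R, (0 <= s' < s)%R & capped W (dim_weight T u s' eps) eps.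
Proof.
move=> /ereal_inf_ltP[_ [s' [s'0 supoo] <-]]; rewrite lte_fin => s's.
exists s'; first by rewrite s'0.
have [K /limn_esup_lt[N hN]] : exists K : R,
    limn_esup (fun n => BS_sum_at T u W s' n eps) < K%:E.
  move: supoo; case: limn_esup => [l||] // _.
    by exists (l + 1)%R; rewrite lte_fin ltrDl.
  by exists 0%R; exact: ltNyr.
exists K, N => n /hN/ereal_inf_ltP[_ [E EW <-] EK].
by exists E => //; exact: ltW.
Qed.

(** The capacity dimensions of the pieces of a cover of [Z] come with different
    exponents below [r]. Raising them to the common exponent [r] requires
    [u(x, n, eps) >= 0], so each piece is first cut according to the time after
    which the Birkhoff sums are nonnegative. *)
Lemma upper_BS_dim_atE u (Z : set X) (eps : R) :
  (forall x, Z x -> exists k : nat,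
     forall n, (k <= n)%N -> (0 <= birkhoff_sum T u n x)%R) ->
  upper_BS_dim_at T u Z eps = critical_dim T scapped u Z eps.
Proof.
move=> hZ; apply/eqP; rewrite eq_le; apply/andP; split.
  apply/ereal_infP => _ [s [s0 [Zs ZZs cZs]] <-]; apply: ge_ereal_inf.
  eexists; first by exists Zs.
  by apply: ge_ereal_sup => _ [i _ <-]; exact: capacity_dim_le.
apply: lee_real => r /ereal_inf_ltP[_ [Zs ZZs <-] supr].
have {}supr i : BS_capacity_dim T u (Zs i) eps < r%:E.
  by apply: le_lt_trans supr; apply: ereal_sup_ubound; exists i.
have [s0 /andP[s00 s0r] _] := capacity_dim_lt (supr 0%N).
apply: ereal_inf_lbound; exists r => //; split.
  exact/ltW/(le_lt_trans s00).
pose Zp k := [set x | Z x /\ forall n, (k <= n)%N ->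
  (0 <= birkhoff_sum T u n x)%R].
have -> : Z = \bigcup_k Zp k.
  apply/seteqP; split=> [x Zx|x [k _ []]//].
  by have [k hk] := hZ x Zx; exists k.
apply: scapped_bigcup => k; exists (fun i => Zs i `&` Zp k).
  by move=> x Zx; have [i _ Zix] := ZZs _ Zx.1; exists i.
move=> i; have [s /andP[s_ge0 sr] cs] := capacity_dim_lt (supr i).
apply: (@capped_le _ _ _ _ _ _ k _ (lexx _) _ cs); first by move=> x [].
move=> [y n] /= kn [x [[_ [_ hx]] yx]]; rewrite /dim_weight leeN2.
rewrite lee_wpmul2r ?lee_fin ?(ltW sr)//.
by apply: le_trans (birkhoff_sup_ge u yx); rewrite lee_fin hx.
Qed.

Lemma upper_BS_dimE u (Z : set X) :
  (forall x, Z x -> exists k : nat,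
     forall n, (k <= n)%N -> (0 <= birkhoff_sum T u n x)%R) ->
  upper_BS_dim T u Z = dimension T scapped u Z.
Proof.
move=> hZ; rewrite /upper_BS_dim /dimension.
suff -> : upper_BS_dim_at T u Z = critical_dim T scapped u Z by [].
by apply/funext => eps; exact: upper_BS_dim_atE.
Qed.

End UpperSmallness.

(** * Lower and upper Bowen equations *)
Theorem theorem4 (R : realType) (X : metricType R) (T : X -> X) (u : X -> R)
    (Z : set X)
    (X_complete : complete_space X) (X_separable : separable_space X)
    (T_continuous : continuous T) (u_unif_continuous : unif_continuous u)
    (Z_nonempty : Z !=set0)
    (Z_averages : forall x, Z x ->
       0 < lower_average T u x /\
       lower_average T u x <= upper_average T u x /\
       upper_average T u x < +oo) :
  (lower_BS_dim T u Z =
     ereal_sup [set s%:E | s in [set s : R | 0 < lower_bowen_fun T u Z s]] /\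
   lower_BS_dim T u Z =
     ereal_inf [set s%:E | s in [set s : R | lower_bowen_fun T u Z s <= 0]]) /\
  (upper_BS_dim T u Z =
     ereal_sup [set s%:E | s in [set s : R | 0 < upper_bowen_fun T u Z s]] /\
   upper_BS_dim T u Z =
     ereal_inf [set s%:E | s in [set s : R | upper_bowen_fun T u Z s <= 0]]) /\
  (bowen_entropy T Z < +oo ->
    (forall beta : R, (forall x, Z x -> upper_average T u x <= beta%:E) ->
       lower_BS_dim T u Z < +oo ->
       exists s0 : R,
         lower_BS_dim T u Z = s0%:E /\ lower_bowen_fun T u Z s0 = 0) /\
    (forall alpha : R, (0 < alpha)%R ->
       (forall x, Z x -> alpha%:E <= lower_average T u x) ->
       (forall s t : R, (0 <= s)%R -> (s < t)%R ->
          lower_bowen_fun T u Z t < lower_bowen_fun T u Z s) /\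
       (forall s t : R, (s < t)%R -> lower_bowen_fun T u Z t < +oo ->
          lower_bowen_fun T u Z t < lower_bowen_fun T u Z s) /\
       (forall s t : R, lower_bowen_fun T u Z s = 0 ->
          lower_bowen_fun T u Z t = 0 -> s = t)) /\
    (forall alpha beta : R, (0 < alpha)%R ->
       (forall x, Z x -> alpha%:E <= lower_average T u x /\
                         upper_average T u x <= beta%:E) ->
       exists s0 : R, lower_BS_dim T u Z = s0%:E /\
         (forall s : R, lower_bowen_fun T u Z s = 0 <-> s = s0))) /\
  (packing_entropy T Z < +oo ->
    (forall beta : R, (forall x, Z x -> upper_average T u x <= beta%:E) ->
       upper_BS_dim T u Z < +oo ->
       exists s0 : R,
         upper_BS_dim T u Z = s0%:E /\ upper_bowen_fun T u Z s0 = 0) /\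
    (forall alpha : R, (0 < alpha)%R ->
       (forall x, Z x -> alpha%:E <= lower_average T u x) ->
       (forall s t : R, (0 <= s)%R -> (s < t)%R ->
          upper_bowen_fun T u Z t < upper_bowen_fun T u Z s) /\
       (forall s t : R, (s < t)%R -> upper_bowen_fun T u Z t < +oo ->
          upper_bowen_fun T u Z t < upper_bowen_fun T u Z s) /\
       (forall s t : R, upper_bowen_fun T u Z s = 0 ->
          upper_bowen_fun T u Z t = 0 -> s = t)) /\
    (forall alpha beta : R, (0 < alpha)%R ->
       (forall x, Z x -> alpha%:E <= lower_average T u x /\
                         upper_average T u x <= beta%:E) ->
       exists s0 : R, upper_BS_dim T u Z = s0%:E /\
         (forall s : R, upper_bowen_fun T u Z s = 0 <-> s = s0))).
Proof.
have Zpos x : Z x -> exists k : nat, forall n, (k <= n)%N ->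
    (0 <= birkhoff_sum T u n x)%R.
  move=> /Z_averages[lo _]; have [k hk] := lower_average_gt lo.
  by exists k => n /hk; rewrite mulr0.
have [lowE lowP] := bowen_equation (null_smallness T) u_unif_continuous
  Z_nonempty Z_averages (lower_BS_dimE T u Z) (lower_pressureE T _ Z)
  (fun s => lower_pressureE T _ Z).
have [upE upP] := bowen_equation (scapped_smallness T) u_unif_continuous
  Z_nonempty Z_averages (upper_BS_dimE Zpos) (upper_pressureE T _ Z)
  (fun s => upper_pressureE T _ Z).
by split=> //; split=> //; split.
Qed.
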